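(* Let $I$ be a tropical ideal in $\overline{\mathbb R}[x_1^{\pm1},\dots,x_n^{\pm1},y_1^{\pm1},\dots,y_m^{\pm1}]$. Then $$V\big(I\cap\overline{\mathbb R}[y_1^{\pm1},\dots,y_m^{\pm1}]\big)=\pi(V(I)),$$ where $\pi:\mathbb R^n\times\mathbb R^m\to\mathbb R^m$ is the projection onto the second factor.
   Context: $\overline{\mathbb R}=(\mathbb R\cup\{\infty\},\min,+)$. $[f]_{\mathbf x^{\mathbf u}}$ is the coefficient of the monomial $\mathbf x^{\mathbf u}$, $f(\mathbf w)=\min_{\mathbf u}([f]_{\mathbf x^{\mathbf u}}+\mathbf u\cdot\mathbf w)$. Tropical ideal: for $f,g\in I$ and a monomial $\mathbf x^{\mathbf u}$ with $[f]_{\mathbf x^{\mathbf u}}=[g]_{\mathbf x^{\mathbf u}}\ne\infty$ there is $h\in I$ with $[h]_{\mathbf x^{\mathbf u}}=\infty$ and $[h]_{\mathbf x^{\mathbf v}}\ge\min([f]_{\mathbf x^{\mathbf v}},[g]_{\mathbf x^{\mathbf v}})$ for all $\mathbf v$, with equality when $[f]_{\mathbf x^{\mathbf v}}\ne[g]_{\mathbf x^{\mathbf v}}$. For an ideal $K$ of a Laurent polynomial semiring in $k$ variables, $V(K)=\{\mathbf w\in\mathbb R^k:$ for every $f\in K$, $f\ne\infty$, the minimum in $f(\mathbf w)$ is attained at least twice$\}$. *)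

(* Defs.v *)
From mathcomp Require Import all_boot all_order all_algebra.
From mathcomp Require Import reals.
Set Implicit Arguments. Unset Strict Implicit. Unset Printing Implicit Defensive.
Import Order.TTheory GRing.Theory Num.Theory.
Local Open Scope ring_scope.

(* Tropical semiring  Rbar = (R u {oo}, min, +): an element is [option R],
   [None] standing for oo. *)
Section Trop.
Variable R : realType.

Definition tmin (a b : option R) : option R :=
  match a, b with
  | None, _ => b
  | _, None => a
  | Some x, Some y => Some (Num.min x y)
  end.

Definition tplus (a b : option R) : option R :=
  match a, b with
  | Some x, Some y => Some (x + y)
  | _, _ => None
  end.

Definition tle (a b : option R) : bool :=
  match a, b with
  | _, None => true
  | None, Some _ => false
  | Some x, Some y => x <= y
  end.

Definition expo (k : nat) := {ffun 'I_k -> int}.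

(* a (Laurent) "polynomial" is its coefficient function; it must be
   finitely supported (see [finsupp]). *)
Definition tpoly (k : nat) := expo k -> option R.

Definition finsupp_with k (f : tpoly k) (s : seq (expo k)) : Prop :=
  forall u, f u <> None -> u \in s.

Definition finsupp k (f : tpoly k) : Prop := exists s, finsupp_with f s.

Definition tzero k : tpoly k := fun _ => None.

Definition tadd k (f g : tpoly k) : tpoly k := fun u => tmin (f u) (g u).

(* product g (.) f, where s is a list containing the support of g:
   (g f)_u = min_{v} (g_v + f_{u-v}) *)
Definition tmul_with k (s : seq (expo k)) (g f : tpoly k) : tpoly k :=
  fun u => \big[tmin/None]_(v <- s) tplus (g v) (f (u - v)).

Definition is_ideal k (I : tpoly k -> Prop) : Prop :=
  [/\ forall f, I f -> finsupp f,
      I (fun _ => None),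
      forall f g, I f -> I g -> I (tadd f g) &
      forall f g s, I f -> finsupp_with g s -> I (tmul_with s g f)].

Definition tropical_ideal k (I : tpoly k -> Prop) : Prop :=
  is_ideal I /\
  forall f g u, I f -> I g -> f u = g u -> f u <> None ->
    exists h, [/\ I h, h u = None &
      forall v, tle (tmin (f v) (g v)) (h v) /\
                (f v <> g v -> h v = tmin (f v) (g v))].

Definition dotp k (u : expo k) (w : 'I_k -> R) : R :=
  \sum_(i < k) (u i)%:~R * w i.

Definition tvar k (K : tpoly k -> Prop) (w : 'I_k -> R) : Prop :=
  forall f, K f -> (exists u, f u <> None) ->
    exists u v a b, [/\ u != v, f u = Some a, f v = Some b,
      a + dotp u w = b + dotp v w &
      forall t c, f t = Some c -> a + dotp u w <= c + dotp t w].

(* inclusion Rbar[y^{+-1}] -> Rbar[x^{+-1}, y^{+-1}] (x = first n variables,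
   y = last m variables) *)
Definition ypoly_embed n m (g : tpoly m) : tpoly (n + m) :=
  fun u => if [forall i : 'I_n, u (lshift m i) == 0]
           then g [ffun j : 'I_m => u (rshift n j)] else None.

Definition elim_ideal n m (I : tpoly (n + m) -> Prop) : tpoly m -> Prop :=
  fun g => I (ypoly_embed (n:=n) g).

Definition proj_y n m (z : 'I_(n + m) -> R) : 'I_m -> R :=
  fun j => z (rshift n j).

End Trop.

(* Main.v *)
Require Import Defs.
From mathcomp Require Import all_boot all_order all_algebra.
From mathcomp Require Import reals boolp.
From mathcomp Require Import zify ring lra.

(* The projection of a point of V(I) kills the polynomials of the elimination
   ideal, so the content is the lifting of a point w, one variable x at a time.
   Suppose that over every x in R some f in I attains its minimum at (x, w)
   only once.

   (1) Noetherianity.  Let a weight move along a ray t -> a + t b.  The leading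
   monomials at t = oo, graded by boxes of exponents, are finitely generated
   (Dickson), and by Gauss-Jordan elimination they are the leading monomials
   for all large t.  Hence a unique minimum at some large t persists, for
   another element of I, up to t = oo.  In particular there are f+, f- in I with
   a unique minimum for all large x and for all large -x.

   (2) Linear duality.  On x-degrees in [-L, L] there is zeta : [-L, L] ->
   R u {oo}, zeta 0 = 0, such that no f in I of x-degree in this range has a
   unique minimum when x^j is replaced by zeta_j.  The values are chosen one
   after the other: an empty set of choices would, by (1), yield a forbidden
   f with smaller support.

   (3) Minimise zeta_j + kappa j^2 for kappa small and L large.  Near the
   minimiser j the parabola is almost a line of slope x = -2 kappa j, so the
   f having a unique minimum at (x, w), with a gap uniform in x by compactness,
   contradicts the choice of zeta. *)

Section TropicalProjection.
Set Implicit Arguments. Unset Strict Implicit. Unset Printing Implicit Defensive.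
Import Order.TTheory GRing.Theory Num.Theory.
Local Open Scope ring_scope.

(** * Leading terms and Gauss-Jordan elimination under a weight *)

Section Domination.
Variables (R : realType) (T : eqType).
Implicit Types (F G H : T -> option R) (K : (T -> option R) -> Prop) (u v : T).

Definition elim_closed K := forall F G u, K F -> K G -> F u = G u ->
  F u <> None ->
  exists H, [/\ K H, H u = None &
      forall v, tle (tmin (F v) (G v)) (H v) /\
                (F v <> G v -> H v = tmin (F v) (G v))].

Definition scale_closed K :=
  forall F c, K F -> K (fun u => tplus (Some c) (F u)).

Definition fin_closed K :=
  forall F, K F -> exists s : seq T, forall u, F u <> None -> u \in s.

(** Scaling [G] by [x - y] equalises the two coefficients at [a]. The last two clauses separate the
    inequality of the elimination axiom from the case of equality where [F] has the strictly smaller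
    coefficient. *)
Lemma eliminate K F G a x y : elim_closed K -> scale_closed K ->
  K F -> K G -> F a = Some x -> G a = Some y ->
  exists H, [/\ K H, H a = None,
    forall v c, H v = Some c ->
      (exists2 c', F v = Some c' & c' <= c) \/
      (exists2 c', G v = Some c' & c' + (x - y) <= c) &
    forall v c, F v = Some c ->
      (forall c', G v = Some c' -> c < c' + (x - y)) -> H v = Some c].
Proof.
move=> Ke Ks KF KG Fa Ga.
have KG' := Ks G (x - y) KG.
have [||H [KH Ha Hv]] := Ke F _ a KF KG'.
- by rewrite Fa Ga /= subrK.
- by rewrite Fa.
exists H; split=> // v c.
- move=> Hc; have [+ _] := Hv v; rewrite Hc.
  case: (F v) => [c1|]; case: (G v) => [c2|] //=.
  + rewrite ge_min => /orP[h|h]; [left; by exists c1|right; exists c2 => //].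
    by rewrite addrC.
  + by left; exists c1.
  + by right; exists c2 => //; rewrite addrC.
- move=> Fc HG; have [_] := Hv v; rewrite Fc.
  case: (G v) HG => [c2|] /= HG.
  + have h := HG _ erefl; move=> ->.
      by rewrite min_l // addrC ltW.
    by case=> h'; move: h; rewrite h' addrC ltxx.
  + by move=> ->.
Qed.

Variable lt : rel T.

(* [u] carries the least weighted coefficient of [F]; ties are broken by [lt]
   when [b] holds and forbidden otherwise. *)
Definition leads (b : bool) (om : T -> R) F u :=
  exists2 a, F u = Some a &
    forall v c, v != u -> F v = Some c ->
      a + om u < c + om v \/ [/\ b, a + om u = c + om v & lt u v].

Hypothesis tie_trans : transitive lt.
Hypothesis tie_irr : irreflexive lt.
Hypothesis tie_total : forall u v, u != v -> lt u v || lt v u.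

Lemma leads_true om b F u : leads b om F u -> leads true om F u.
Proof.
case=> a Fa h; exists a => // v c vu Fv.
by case: (h v c vu Fv) => [?|[_ ? ?]]; [left|right].
Qed.

(** The multiple of [G] that cancels [a] has no term lighter than that of [F] at [a], which itself
    does not beat [u]; so [u] is never undercut. The same [H] serves both values of [b]: a strict
    minimum stays strict. *)
Lemma reduce_one K om F G u a : elim_closed K -> scale_closed K ->
  K F -> K G -> leads true om F u -> leads true om G a -> a != u ->
  exists H, [/\ K H, H a = None,
    forall b, leads b om F u -> leads b om H u &
    forall v, F v = None -> G v = None -> H v = None].
Proof.
move=> Ke Ks KF KG [x Fu domF] [y Ga domG] au.
case Fa : (F a) => [z|]; last by exists F.
have [H [KH Ha H1 H2]] := eliminate Ke Ks KF KG Fa Ga.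
have ltua := domF a z au Fa.
have Hu : H u = Some x.
  apply: H2 => // c' Gu.
  have ua : u != a by rewrite eq_sym.
  case: (domG u c' ua Gu) => [h|[_ h luv]]; case: ltua => [h'|[_ h' lvu]]; try lra.
  by have := tie_trans luv lvu; rewrite tie_irr.
exists H; split=> //.
- move=> b [x' Fu' domb]; move: Fu'; rewrite Fu => -[?]; subst x'.
  exists x => // v c vu Hv.
  case: (H1 v c Hv) => -[c' Ec hc].
    case: (domb v c' vu Ec) => [h|[-> h l]]; first by left; lra.
    move: hc; rewrite le_eqVlt => /orP[/eqP<-|hc]; first by right.
    by left; lra.
  have va : v != a by apply: contraPneq Hv => ->; rewrite Ha.
  case: (domG v c' va Ec) => h; case: (domb a z au Fa) => h'.
  + by left; lra.
  + by case: h' => _ h' _; left; lra.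
  + by case: h => _ h _; left; lra.
  + case: h => _ h l; case: h' => -> h' l'.
    have : x + om u <= c + om v by lra.
    rewrite le_eqVlt => /orP[/eqP E|]; last by left.
    by right; split=> //; apply: tie_trans l' l.
- move=> v Fv Gv; case Hv: (H v) => [c|] //.
  by case: (H1 v c Hv) => -[c']; rewrite ?Fv ?Gv.
Qed.

Definition reduced K om (A : seq T) := forall a, a \in A ->
  exists G, [/\ K G, leads true om G a &
    forall a', a' \in A -> a' != a -> G a' = None].

(** The row used to clear one pivot vanishes at the others, so pivots already cleared stay clear. *)
Lemma reduce K om A F u : elim_closed K -> scale_closed K ->
  reduced K om A -> K F -> leads true om F u -> u \notin A ->
  exists H, [/\ K H, forall b, leads b om F u -> leads b om H u &
    forall a, a \in A -> H a = None].
Proof.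
move=> Ke Ks rA KF domF uA.
suff : forall C : seq T, {subset C <= A} ->
   exists H, [/\ K H, forall b, leads b om F u -> leads b om H u &
    forall a, a \in C -> H a = None].
  by apply.
elim=> [|c C IH] CA; first by exists F.
have [|H [KH dH HC]] := IH; first by move=> x xC; apply: CA; rewrite inE xC orbT.
have cA : c \in A by apply: CA; rewrite inE eqxx.
have [G [KG dG GA]] := rA c cA.
have cu : c != u by apply: contraNneq uA => <-.
have [H' [KH' H'c dH' H'N]] := reduce_one Ke Ks KH KG (dH _ domF) dG cu.
exists H'; split=> //; first by move=> b /dH /dH'.
move=> a; rewrite inE; have [->//|ac] := eqVneq a c.
move=> /= aC; apply: H'N; first exact: HC.
by apply: GA => //; apply: CA; rewrite inE aC orbT.
Qed.

(** The new row is first cleared at the old pivots, then used to clear its own pivot from the old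
    rows. *)
Lemma gauss_jordan K om A : elim_closed K -> scale_closed K -> uniq A ->
  (forall a, a \in A -> exists2 G, K G & leads true om G a) -> reduced K om A.
Proof.
move=> Ke Ks; elim: A => [|u A IH] //= /andP[uA Au] hA.
have rA : reduced K om A.
  by apply: IH => // a aA; apply: hA; rewrite inE aA orbT.
have [F KF dF] : exists2 G, K G & leads true om G u.
  by apply: hA; rewrite inE eqxx.
have [H [KH dH HA]] := reduce Ke Ks rA KF dF uA.
move=> a; rewrite inE; have [-> _|au /= aA] := eqVneq a u.
  exists H; split=> //; first exact: dH.
  by move=> a'; rewrite inE => /orP[/eqP->|/HA //]; rewrite eqxx.
have [G [KG dG GA]] := rA a aA.
have ua : u != a by rewrite eq_sym.
have [G' [KG' G'u dG' G'N]] := reduce_one Ke Ks KG KH dG (dH _ dF) ua.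
exists G'; split=> //; first exact: dG'.
move=> a'; rewrite inE; have [-> //|a'u /= a'A] := eqVneq a' u.
by move=> a'a; apply: G'N; [exact: GA|exact: HA].
Qed.

Lemma exists_least (X : eqType) (r : X -> X -> Prop) (s : seq X) :
  (forall x y z, r x y -> r y z -> r x z) ->
  (forall x y, x != y -> r x y \/ r y x) -> s != [::] ->
  exists2 x, x \in s & forall y, y \in s -> y != x -> r x y.
Proof.
move=> rt rtot; elim: s => // x s IH _.
have [->|/IH [y ys hy]] := eqVneq s [::].
  by exists x; rewrite ?inE // => y; rewrite inE => /eqP->; rewrite eqxx.
have [xy|xy] := eqVneq x y.
  exists x; rewrite ?inE ?eqxx // => z; rewrite inE.
  by case: (eqVneq z x) => //= zx zs _; rewrite xy; apply: hy => //; rewrite -xy.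
case: (rtot x y xy) => h.
  exists x; rewrite ?inE ?eqxx // => z; rewrite inE => /orP[/eqP->|zs].
    by rewrite eqxx.
  by move=> _; have [->//|zy] := eqVneq z y; apply: rt h _; apply: hy.
exists y; rewrite ?inE ?ys ?orbT // => z; rewrite inE => /orP[/eqP-> //|zs] zy.
exact: hy.
Qed.

Lemma exists_least_coeff (r : R * T -> R * T -> Prop) F (s : seq T) u0 :
  (forall x y z, r x y -> r y z -> r x z) ->
  (forall x y, x.2 != y.2 -> r x y \/ r y x) ->
  (forall u, F u <> None -> u \in s) -> F u0 <> None ->
  exists u a, F u = Some a /\
    forall v c, v != u -> F v = Some c -> r (a, u) (c, v).
Proof.
move=> rt rtot hs Fu0.
pose r' u v := if F u is Some a then
    if F v is Some c then r (a, u) (c, v) else True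
  else if F v is Some _ then False else lt u v.
have [|||u us hu] := @exists_least _ r' s.
- move=> x y z; rewrite /r'.
  by case: (F x) (F y) (F z) => [?|] [?|] [?|] //; [apply: rt|apply: tie_trans].
- move=> x y xy; rewrite /r'.
  case: (F x) (F y) => [c|] [d|]; [exact: rtot|by left|by right|].
  exact/orP/tie_total.
- by apply: contraPneq (hs _ Fu0) => ->.
have Fu : F u <> None.
  move=> Fu; have [E|ne] := eqVneq u0 u; first by rewrite E in Fu0.
  by have := hu u0 (hs _ Fu0) ne; rewrite /r' Fu; case: (F u0) Fu0.
case Eu: (F u) Fu => [a|] // _; exists u, a; split=> // v c vu Fv.
by have := hu v (hs v ltac:(by rewrite Fv)) vu; rewrite /r' Eu Fv.
Qed.

Lemma exists_leads K om F u0 : fin_closed K -> K F -> F u0 <> None ->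
  exists u, leads true om F u.
Proof.
move=> Kf KF Fu0; have [s hs] := Kf F KF.
have [||u [a [Fu h]]] := @exists_least_coeff (fun x y =>
   x.1 + om x.2 < y.1 + om y.2 \/ [/\ true, x.1 + om x.2 = y.1 + om y.2 & lt x.2 y.2])
   F s u0 _ _ hs Fu0.
- move=> x y z [h|[_ h l]] [h'|[_ h' l']]; try by left; lra.
  by right; split=> //; [lra|apply: tie_trans l l'].
- move=> x y xy; have [h|h|h] := ltgtP (x.1 + om x.2) (y.1 + om y.2).
  + by left; left.
  + by right; left.
  + by case/orP: (tie_total xy) => ?; [left|right]; right.
by exists u; exists a.
Qed.

Variable be : T -> R.

(** The limit of [leads true] for the weights [t * be] as [t] tends to infinity: slopes count first,
    then coefficients, then [lt]. *)
Definition leads_infty F u :=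
  exists2 a, F u = Some a & forall v c, v != u -> F v = Some c ->
    be u < be v \/ be u = be v /\ (a < c \/ a = c /\ lt u v).

Lemma exists_leads_infty K F u0 : fin_closed K -> K F -> F u0 <> None ->
  exists u, leads_infty F u.
Proof.
move=> Kf KF Fu0; have [s hs] := Kf F KF.
have [||u [a [Fu h]]] := @exists_least_coeff (fun x y =>
   be x.2 < be y.2 \/ be x.2 = be y.2 /\ (x.1 < y.1 \/ x.1 = y.1 /\ lt x.2 y.2))
   F s u0 _ _ hs Fu0.
- move=> x y z [h|[h l]] [h'|[h' l']]; try by left; lra.
  right; split; first by lra.
  case: l l' => [?|[? l]] [?|[? l']]; try by left; lra.
  by right; split; [lra|apply: tie_trans l l'].
- move=> x y xy; have [h|h|h] := ltgtP (be x.2) (be y.2).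
  + by left; left.
  + by right; left.
  have [h'|h'|h'] := ltgtP x.1 y.1.
  + by left; right; split=> //; left.
  + by right; right; split=> //; left.
  + by case/orP: (tie_total xy) => ?; [left|right]; right; split=> //; right.
by exists u; exists a.
Qed.

Lemma list_bound (X : eqType) (s : seq X) (P : X -> R -> Prop) :
  (forall x t t', t <= t' -> P x t -> P x t') ->
  (forall x, x \in s -> exists t, P x t) ->
  exists t, forall x, x \in s -> P x t.
Proof.
move=> mon; elim: s => [|x s IH] hs; first by exists 0.
have [|t ht] := IH; first by move=> y ys; apply: hs; rewrite inE ys orbT.
have [|t' ht'] := hs x; first by rewrite inE eqxx.
exists (Num.max t t') => y; rewrite inE => /orP[/eqP->|ys].
  by apply: mon ht'; rewrite le_max lexx orbT.
by apply: mon (ht y ys); rewrite le_max lexx.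
Qed.

Lemma leads_infty_eventually K F u : fin_closed K -> K F -> leads_infty F u ->
  exists X, forall t, X <= t -> leads true (fun v => t * be v) F u.
Proof.
move=> Kf KF [a Fu h]; have [s hs] := Kf F KF.
have [||X hX] := @list_bound _ s (fun v X => forall t, X <= t -> forall c, v != u ->
   F v = Some c ->
   a + t * be u < c + t * be v \/ [/\ true, a + t * be u = c + t * be v & lt u v]).
- by move=> v t t' tt' P t'' ?; apply: P; lra.
- move=> v _; case Fv: (F v) => [c|]; last by exists 0.
  have [->|vu] := eqVneq v u; first by exists 0.
  case: (h v c vu Fv) => [h'|[h' [h''|[h'' l]]]].
  + exists ((a - c) / (be v - be u) + 1) => t ht c' _ [<-]; left.
    have d0 : 0 < be v - be u by lra.
    have : (a - c) / (be v - be u) < t by lra.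
    rewrite ltr_pdivrMr //; lra.
  + by exists 0 => t ht c' _ [<-]; left; rewrite h'; lra.
  + by exists 0 => t ht c' _ [<-]; right; rewrite h' h''.
exists X => t ht; exists a => // v c vu Fv.
by apply: (hX v) => //; apply: hs; rewrite Fv.
Qed.

End Domination.

(** * Dickson's lemma and leading monomials along a ray of weights *)

Section Stabilization.

(** Induction on the number of coordinates: with [N] a bound for the last coordinate on [L], the
    points at height at least [N] are handled by [L], and each of the finitely many levels below is
    an instance with one coordinate fewer. *)
Lemma dickson (r : nat) (X : eqType) (phi : X -> nat -> nat) (P : X -> Prop) :
  exists2 L : seq X, forall x, x \in L -> P x &
    forall y, P y -> exists2 x, x \in L & forall i, (i < r)%N -> (phi x i <= phi y i)%N.
Proof.
elim: r P => [|r IH] P.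
  have [[x Px]|nP] := pselect (exists x, P x).
    exists [:: x]; first by move=> y; rewrite inE => /eqP->.
    by move=> y _; exists x; rewrite ?inE.
  by exists [::] => // y Py; case: nP; exists y.
have [L LP hL] := IH P.
have [N hN] : exists N, forall x, x \in L -> (phi x r <= N)%N.
  elim: L {LP hL} => [|x L [N hN]]; first by exists 0%N.
  exists (maxn (phi x r) N) => y; rewrite inE leq_max => /orP[/eqP->|/hN->].
    by rewrite leqnn.
  by rewrite orbT.
have [L' L'P hL'] : exists2 L : seq X, forall x, x \in L -> P x &
    forall y, P y -> (phi y r < N)%N -> exists2 x, x \in L & forall i, (i < r.+1)%N -> (phi x i <= phi y i)%N.
  elim: N {hN} => [|N [L1 L1P hL1]]; first by exists [::].
  have [L2 L2P hL2] := IH (fun y => P y /\ phi y r = N).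
  exists (L1 ++ L2).
    by move=> x; rewrite mem_cat => /orP[/L1P|/L2P[]].
  move=> y Py; rewrite ltnS leq_eqVlt => /orP[/eqP E|lt].
    have [x xL hx] := hL2 y (conj Py E).
    exists x; first by rewrite mem_cat xL orbT.
    move=> i; rewrite ltnS leq_eqVlt => /orP[/eqP->|/hx //].
    by have [_ ->] := L2P x xL; rewrite E.
  have [x xL hx] := hL1 y Py lt.
  by exists x => //; rewrite mem_cat xL.
exists (L ++ L'); first by move=> x; rewrite mem_cat => /orP[/LP|/L'P].
move=> y Py; have [lt|ge] := ltnP (phi y r) N.
  by have [x xL hx] := hL' y Py lt; exists x; rewrite // mem_cat xL orbT.
have [x xL hx] := hL y Py; exists x; first by rewrite mem_cat xL.
move=> i; rewrite ltnS leq_eqVlt => /orP[/eqP->|/hx //].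
exact: leq_trans (hN x xL) ge.
Qed.

Lemma dickson_fin (I : finType) (X : eqType) (phi : X -> I -> nat) (P : X -> Prop) :
  exists2 L : seq X, forall x, x \in L -> P x &
    forall y, P y -> exists2 x, x \in L & forall i, (phi x i <= phi y i)%N.
Proof.
have [L LP hL] := dickson #|I|
  (fun x j => if insub j is Some o then phi x (enum_val (o : 'I_#|I|)) else 0%N) P.
exists L => // y /hL[x xL hx]; exists x => // i.
by have := hx _ (ltn_ord (enum_rank i)); rewrite valK enum_rankK.
Qed.

Variables (R : realType) (T : eqType) (lt : rel T).
Hypothesis tie_trans : transitive lt.
Hypothesis tie_irr : irreflexive lt.
Hypothesis tie_total : forall u v, u != v -> lt u v || lt v u.

Variables (be : T -> R) (J : (T -> option R) -> Prop).
Hypothesis Je : elim_closed J.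
Hypothesis Js : scale_closed J.
Hypothesis Jf : fin_closed J.

Variables (box : nat -> pred T) (bseq : nat -> seq T).
Hypothesis bseqP : forall d u, box d u -> u \in bseq d.

(** Boxes play the part of degrees in a grading: each is finite, so elimination terminates in it,
    and [Jshift] makes the pairs of a box and a leading monomial upward closed for [phi], hence
    finitely generated. *)
Definition in_box d F := J F /\ forall u, F u <> None -> box d u.

Variables (I : finType) (phi : nat * T -> I -> nat).
Hypothesis Jshift : forall d u d' u', box d u -> box d' u' ->
  (forall i, (phi (d, u) i <= phi (d', u') i)%N) ->
  forall F, in_box d F -> exists2 F', in_box d' F' &
    forall t, leads lt true (fun v => t * be v) F u ->
              leads lt true (fun v => t * be v) F' u'.

Let om t := fun v => t * be v.

Lemma in_box_elim d : elim_closed (in_box d).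
Proof.
move=> F G u [JF bF] [JG bG] FG Fu.
have [H [JH Hu Hv]] := Je JF JG FG Fu.
exists H; split=> //; split=> // v Hvn.
have [+ _] := Hv v.
case EF: (F v) => [?|]; first by move=> _; apply: bF; rewrite EF.
case EG: (G v) => [?|]; first by move=> _; apply: bG; rewrite EG.
by case: (H v) Hvn.
Qed.

Lemma in_box_scale d : scale_closed (in_box d).
Proof.
move=> F c [JF bF]; split; first exact: Js.
by move=> u h; apply: bF => E; rewrite E in h.
Qed.

Lemma in_box_fin d : fin_closed (in_box d).
Proof. by move=> F [/Jf]. Qed.

Let Minf d u := exists2 G, in_box d G & leads_infty lt be G u.
Let M t d u := exists2 G, in_box d G & leads lt true (om t) G u.

Let Mbox t d u : M t d u -> box d u.
Proof. by case=> G [_ bG] [a Gu _]; apply: bG; rewrite Gu. Qed.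

(** Dickson's lemma leaves finitely many generating pairs, hence a common threshold; [Jshift] acts
    at every [t] at once, so this threshold serves all boxes. *)
Lemma leads_infty_subset : exists X, forall t, X <= t ->
  forall d u, Minf d u -> M t d u.
Proof.
have [L LP hL] := dickson_fin phi (fun p : nat * T => Minf p.1 p.2).
have [||X hX] := @list_bound R _ L (fun p X => exists2 G, in_box p.1 G &
   forall t, X <= t -> leads lt true (om t) G p.2).
- by move=> x t t' tt' [G bG h]; exists G => // t'' ?; apply: h; lra.
- move=> p /LP [G bG h].
  have [X hX] := leads_infty_eventually (@in_box_fin p.1) bG h.
  by exists X, G.
exists X => t ht d u Mdu.
have [[d' u'] /hX /= [G bG h] hphi] := hL (d, u) Mdu.
have bu' : box d' u'.
  by case: bG => _; apply; have [a ->] := h t ht.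
have bu : box d u.
  by case: Mdu => G' [_ bG'] [a G'u _]; apply: bG'; rewrite G'u.
have [G' bG' h'] := Jshift bu' bu hphi bG.
by exists G' => //; apply/h'/h.
Qed.

(** Gauss-Jordan elimination with all other leading monomials of the box as pivots. *)
Lemma reduced_vector t d F u : in_box d F -> leads lt true (om t) F u ->
  exists H, [/\ in_box d H,
    forall b, leads lt b (om t) F u -> leads lt b (om t) H u &
    forall a, a != u -> M t d a -> H a = None].
Proof.
move=> bF dF.
pose A := [seq a <- undup (bseq d) | `[<M t d a>] && (a != u)].
have AP a : a != u -> M t d a -> a \in A.
  move=> au Ma; rewrite mem_filter au mem_undup bseqP ?andbT; first exact/asboolP.
  exact: Mbox Ma.
have [||H [bH dH HA]] := reduce tie_trans tie_irr (@in_box_elim d) (@in_box_scale d)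
    (om := om t) (A := A) _ bF dF.
- apply: (gauss_jordan tie_trans tie_irr (@in_box_elim d) (@in_box_scale d)).
    by rewrite filter_uniq ?undup_uniq.
  by move=> a; rewrite mem_filter => /andP[/andP[/asboolP]].
- by rewrite mem_filter eqxx andbF.
by exists H; split=> // a au Ma; apply: HA; apply: AP.
Qed.

(* The weight [t * be] selects the same leading monomials for all large [t]:
   those at infinity are contained in those at [t], and a reduced vector
   supported on the complement of the former plus one monomial must be led
   by that monomial. *)
Lemma leading_stable : exists X, forall t0, X <= t0 -> forall d F u,
  in_box d F -> leads lt false (om t0) F u ->
  exists2 F', in_box d F' & forall t, t0 <= t -> leads lt false (om t) F' u.
Proof.
have [X hX] := leads_infty_subset; exists X.
(* Conversely, the monomial leading the reduced vector at infinity is also a leading one at [t], and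
   [u] is the only such monomial in its support. *)
have hX' t d u : X <= t -> M t d u -> Minf d u.
  move=> Xt [F bF dF].
  have [H [bH /(_ _ dF) dH HN]] := reduced_vector bF dF.
  have Hu : H u <> None by have [a ->] := dH.
  have [v dv] := exists_leads_infty tie_trans tie_total be (@in_box_fin d) bH Hu.
  have Mv : Minf d v by exists H.
  suff <- : v = u by [].
  apply/eqP/negPn/negP => vu; have := HN v vu (hX t Xt d v Mv).
  by have [a ->] := dv.
move=> t0 Xt0 d F u bF dF.
have [H [bH dH HN]] := reduced_vector bF (leads_true dF).
have dHs := dH _ dF.
exists H => // t tt0.
have Hu : H u <> None by have [a ->] := dHs.
(* From [X] on the leading monomials are those at infinity, hence the same at [t'] and at [t0]; the
   one of [H] can only be [u]. *)
have lead t' : X <= t' -> leads lt true (om t') H u.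
  move=> Xt'.
  have [v dv] := exists_leads (lt := lt) tie_trans tie_total (om t') (@in_box_fin d) bH Hu.
  suff <- : v = u by [].
  have Mv : M t' d v by exists H.
  apply/eqP/negPn/negP => vu; have := HN v vu (hX t0 Xt0 d v (hX' t' d v Xt' Mv)).
  by have [a ->] := dv.
case: dHs => a Ha strict; exists a => // v c vu Hv; left.
have := strict v c vu Hv; rewrite /om; case=> [s|[]//].
have [le|gt] := lerP (be u) (be v).
  have : (t - t0) * be u <= (t - t0) * be v by apply: ler_wpM2l => //; lra.
  by lra.
(* Past the crossing point [(c - a) / (be u - be v)] the term at [v] would be the smaller one,
   although [u] still leads. *)
pose t1 := Num.max X ((c - a) / (be u - be v) + 1).
have [|a' Ha' /(_ v c vu Hv)] := lead t1; first by rewrite le_max lexx.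
move: Ha'; rewrite Ha => -[<-] h.
have d0 : 0 < be u - be v by lra.
have : (c - a) / (be u - be v) < t1.
  by rewrite lt_max; apply/orP; right; lra.
rewrite ltr_pdivrMr // => h1.
by exfalso; case: h => [h|[_ h _]]; rewrite /om in h; lra.
Qed.

End Stabilization.

(** * Laurent exponents, lexicographic ties and unique minima *)

Section Exponents.
Variables (R : realType) (k : nat).
Implicit Types (F G H : expo k -> option R) (u v : expo k).

(** Ties are broken by an order invariant under translation, hence compatible with multiplication by
    monomials. *)
Definition lex u v :=
  [exists i, (u i < v i) && [forall j : 'I_k, (j < i)%N ==> (u j == v j)]].

Lemma lexP u v :
  reflect (exists i, u i < v i /\ forall j : 'I_k, (j < i)%N -> u j = v j) (lex u v).
Proof.
apply: (iffP existsP) => -[i].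
  by move=> /andP[h /forallP hj]; exists i; split=> // j ji; apply/eqP/(implyP (hj j)).
move=> [h hj]; exists i; rewrite h; apply/forallP => j; apply/implyP => ji.
exact/eqP/hj.
Qed.

Lemma lex_irr : irreflexive lex.
Proof. by move=> u; apply/negbTE/negP; move/lexP=> [i []]; rewrite ltxx. Qed.

Lemma lex_trans : transitive lex.
Proof.
move=> v u w; case/lexP=> i [ui hi]; case/lexP=> j [vj hj]; apply/lexP.
case: (ltngtP i j) => [ij|ji|/val_inj E].
- exists i; rewrite -(hj _ ij); split=> // l li; rewrite hi // hj //.
  exact: ltn_trans ij.
- exists j; rewrite (hi _ ji); split=> // l lj; rewrite hi // ?hj //.
  exact: ltn_trans ji.
- subst j; exists i; split; first exact: lt_trans vj.
  by move=> l li; rewrite hi // hj.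
Qed.

Lemma lex_total u v : u != v -> lex u v || lex v u.
Proof.
move=> uv.
have [i0 hi0] : exists i, u i != v i.
  apply/existsP; rewrite -negb_forall; apply: contra uv => /forallP h.
  by apply/eqP/ffunP => i; apply/eqP.
case: (@arg_minnP _ i0 (fun i => u i != v i) (fun i => i : nat) hi0) => i hi hmin.
have heq (j : 'I_k) : (j < i)%N -> u j = v j.
  by move=> ji; apply/eqP/negPn/negP => /hmin; rewrite leqNgt ji.
case: (ltgtP (u i) (v i)) hi => // h _; apply/orP; [left|right]; apply/lexP; exists i.
  by split.
by split=> // j /heq.
Qed.

Lemma lexD u v w : lex (u + w) (v + w) = lex u v.
Proof.
rewrite /lex; apply: eq_existsb => i; rewrite !ffunE ltrD2r; congr andb.
by apply: eq_forallb => j; rewrite !ffunE (inj_eq (addIr _)).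
Qed.

Definition uniq_min (om : expo k -> R) F u :=
  exists2 a, F u = Some a &
    forall v c, v != u -> F v = Some c -> a + om u < c + om v.

Lemma expoBE u v i : (u - v) i = u i - v i.
Proof. by rewrite !ffunE. Qed.

Lemma uniq_minE om F u : uniq_min om F u <-> leads lex false om F u.
Proof.
split=> -[a Fu h]; exists a => // v c vu Fv; have := h v c vu Fv; first by left.
by case=> // -[].
Qed.

Lemma leads_shift b om F u v c :
  (forall x, om (x + v) = om x + c) -> leads lex b om F u ->
  leads lex b om (fun x => F (x - v)) (u + v).
Proof.
move=> hom [a Fu h]; exists a; first by rewrite addrK.
move=> x d xu Fx; have xvu : x - v != u by rewrite subr_eq.
have := h _ _ xvu Fx; rewrite hom.
have -> : om x = om (x - v) + c by rewrite -hom subrK.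
have -> : lex (u + v) x = lex u (x - v) by rewrite -(lexD u (x - v) v) subrK.
case=> [?|[-> ? ->]]; [left; lra|right; split=> //; lra].
Qed.

Lemma eq_uniq_min om om' F u : om =1 om' -> uniq_min om F u -> uniq_min om' F u.
Proof. by move=> e [a Fu h]; exists a => // v c vu Fv; rewrite -!e; apply: h. Qed.

Lemma expo_bound (s : seq (expo k)) :
  exists N : nat, forall u, u \in s -> forall i, (`|u i| <= N)%N.
Proof.
elim: s => [|u s [N hN]]; first by exists 0%N.
exists (maxn (\max_i `|u i|%N) N) => v; rewrite inE => /orP[/eqP->|/hN h] i.
  by rewrite leq_max leq_bigmax.
by rewrite leq_max h orbT.
Qed.

Variables (ok : pred 'I_k) (L : nat) (be : expo k -> R).
Variables (J : (expo k -> option R) -> Prop).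
Hypothesis Je : elim_closed J.
Hypothesis Js : scale_closed J.
Hypothesis Jf : fin_closed J.
Hypothesis Jm : forall F v, (forall i, ~~ ok i -> v i = 0) -> J F ->
  J (fun u => F (u - v)).
Hypothesis be_shift : forall v, (forall i, ~~ ok i -> v i = 0) ->
  exists c, forall u, be (u + v) = be u + c.
Hypothesis JL : forall F u i, J F -> F u <> None -> ~~ ok i -> (`|u i| <= L)%N.

(** Box [d] is [[0, d]] in the coordinates of [ok] and [[-L, L]] in the others. Comparing the
    distances [phi] to both faces forces equality where the length is fixed, and elsewhere leaves
    the shifts that carry box [d] into box [d']. *)
Let lo i : int := if ok i then 0 else - L%:Z.
Let up i (d : nat) : int := if ok i then d%:Z else L%:Z.
Let box (d : nat) : pred (expo k) := fun u => [forall i, lo i <= u i <= up i d].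
Let bseq (d : nat) : seq (expo k) :=
  [seq [ffun i => (g i : nat)%:Z - L%:Z] | g : {ffun 'I_k -> 'I_(d + L + L).+1}].
Let phi (p : nat * expo k) (j : 'I_k * bool) : nat :=
  if j.2 then `|p.2 j.1 - lo j.1|%N else `|up j.1 p.1 - p.2 j.1|%N.

Let boxP d u : reflect (forall i, lo i <= u i <= up i d) (box d u).
Proof. exact: forallP. Qed.

(** Since [leading_stable] lives in boxes, [F] is first translated into one along the coordinates of
    [ok], where [u'] may therefore differ from [u]. *)
Lemma eventually_uniq_min : exists X, forall t0, X <= t0 -> forall F u, J F ->
  uniq_min (fun v => t0 * be v) F u ->
  exists F' u', [/\ J F', forall i, ~~ ok i -> u' i = u i &
    forall t, t0 <= t -> uniq_min (fun v => t * be v) F' u'].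
Proof.
have bseqP d u : box d u -> u \in bseq d.
  move=> /boxP bu; apply/mapP.
  exists [ffun i => inord `|u i + L%:Z|]; first by rewrite mem_enum.
  apply/ffunP => i; rewrite !ffunE; have := bu i; rewrite /lo /up.
  by move: (u i : int) => y h; rewrite inordK; case: (ok i) h; lia.
have Jsh d u d' u' : box d u -> box d' u' ->
  (forall i, (phi (d, u) i <= phi (d', u') i)%N) ->
  forall F, in_box J box d F -> exists2 F', in_box J box d' F' &
    forall t, leads lex true (fun v => t * be v) F u ->
              leads lex true (fun v => t * be v) F' u'.
  move=> /boxP bu /boxP bu' hphi F [JF bF]; pose v := u' - u.
  have hv i : if ok i then 0 <= v i /\ v i + d <= d' else v i = 0.
    have := hphi (i, true); have := hphi (i, false).
    have := bu i; have := bu' i; rewrite /phi /lo /up /v !ffunE /=.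
    by move: (u i : int) (u' i : int) => y y'; case: (ok i); lia.
  have v0 i : ~~ ok i -> v i = 0 by move=> nok; have := hv i; rewrite (negbTE nok).
  exists (fun x => F (x - v)).
    split; first exact: Jm.
    move=> x Fx; apply/boxP => i; have := boxP _ _ (bF _ Fx) i; have := hv i.
    rewrite /lo /up !ffunE.
    by move: (x i : int) (u i : int) (u' i : int) => z y y'; case: (ok i); lia.
  move=> t dF; have [c hc] := be_shift v0.
  rewrite -(subrK u u') [u' - u + u]addrC -/v.
  apply: (leads_shift (c := t * c)) => // x.
  by rewrite hc mulrDr.
have [X hX] := leading_stable lex_trans lex_irr lex_total Je Js Jf bseqP Jsh.
exists X => t0 Xt0 F u JF /uniq_minE dF.
have [s hs] := Jf JF; have [N hN] := expo_bound s.
pose v : expo k := [ffun i => if ok i then N%:Z else 0].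
have v0 i : ~~ ok i -> v i = 0 by rewrite ffunE => /negbTE->.
have [c hc] := be_shift v0.
have [||F' [JF' _] hF'] := hX t0 Xt0 (N + N)%N (fun x => F (x - v)) (u + v).
- split; first exact: Jm.
  move=> x Fx; apply/boxP => i; have := hN _ (hs _ Fx) i.
  have := JL (i := i) JF Fx; rewrite /lo /up !ffunE.
  by move: (x i : int) => y; case: (ok i) => /=; [|move/(_ isT)]; lia.
- by apply: (leads_shift (c := t0 * c)) dF => x; rewrite hc mulrDr.
exists F', (u + v); split=> //.
- by move=> i /v0; rewrite !ffunE => ->; rewrite addr0.
- by move=> t tt0; apply/uniq_minE/hF'.
Qed.

End Exponents.

(** * Adjusting the value of a functional at one power [x^N] *)

Section LinearStep.
Variables (R : realType) (k : nat).
Implicit Types (F G H : expo k -> option R) (u v : expo k).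

Lemma positive_list_bound (X : eqType) (s : seq X) (P : X -> R -> Prop) :
  (forall x t t', t' <= t -> P x t -> P x t') ->
  (forall x, x \in s -> exists2 t, 0 < t & P x t) ->
  exists2 t, 0 < t & forall x, x \in s -> P x t.
Proof.
move=> mon; elim: s => [|x s IH] hs; first by exists 1.
have [|t t0 ht] := IH; first by move=> y ys; apply: hs; rewrite inE ys orbT.
have [|t' t'0 ht'] := hs x; first by rewrite inE eqxx.
exists (Num.min t t'); first by rewrite lt_min t0.
move=> y; rewrite inE => /orP[/eqP->|ys].
  by apply: mon ht'; rewrite ge_min lexx orbT.
by apply: mon (ht y ys); rewrite ge_min lexx.
Qed.

Lemma uniq_min_gap (K : (expo k -> option R) -> Prop) om F u :
  fin_closed K -> K F -> uniq_min om F u ->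
  exists2 a, F u = Some a & exists2 e, 0 < e &
    forall v c, v != u -> F v = Some c -> a + om u + e <= c + om v.
Proof.
move=> Kf KF [a Fu h]; exists a => //; have [s hs] := Kf F KF.
have [||e e0 he] := @positive_list_bound _ s (fun v e => forall c, v != u ->
  F v = Some c -> a + om u + e <= c + om v).
- by move=> v t t' tt' P c vu Fv; have := P c vu Fv; lra.
- move=> v _; case Fv: (F v) => [c|]; last by exists 1.
  have [->|vu] := eqVneq v u; first by exists 1.
  exists (c + om v - (a + om u)); first by have := h v c vu Fv; lra.
  by move=> c' _ [<-]; lra.
by exists e => // v c vu Fv; apply: (he v) => //; apply: hs; rewrite Fv.
Qed.

Variables (i0 : 'I_k) (L : nat) (N : int) (J : (expo k -> option R) -> Prop).
Hypothesis Je : elim_closed J.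
Hypothesis Js : scale_closed J.
Hypothesis Jf : fin_closed J.
Hypothesis Jm : forall F v, v i0 = 0 -> J F -> J (fun u => F (u - v)).
Hypothesis JL : forall F u, J F -> F u <> None -> (`|u i0| <= L)%N.

Let ind u : R := (u i0 == N)%:R.
(** The weight added when the value of the functional at [x^N] is raised by [t]. *)
Let om t u : R := t * ind u.

Let indN u : u i0 = N -> ind u = 1.
Proof. by rewrite /ind => ->; rewrite eqxx. Qed.
Let indnN u : u i0 != N -> ind u = 0.
Proof. by rewrite /ind => /negbTE->. Qed.

(* Each elimination of a monomial [x^N y^v] of [F] by a shift of [G] only
   brings in terms of larger weight, so finitely many of them suffice. *)
Lemma uniq_min_lower F G u v0 e tau e' : J F -> J G -> u i0 != N -> v0 i0 = N ->
  0 <= e' < e ->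
  (exists2 b, G v0 = Some b &
     forall v c, v != v0 -> G v = Some c -> b + om tau v0 + e <= c + om tau v) ->
  uniq_min (om (tau + e')) F u ->
  exists2 F', J F' & uniq_min (om tau) F' u.
Proof.
move=> JF JG uN v0N /andP[e'0 e'e] [b Gv0 hG].
rewrite /om (indN v0N) in hG.
have [s hs] := Jf JF.
move=> [a Fu]; rewrite /om indnN // => hF.
have hC : forall v, v \in s \/ ~ (exists2 c, F v = Some c & v i0 = N /\ c + tau <= a).
  move=> v; case: (boolP (v \in s)) => vs; [by left|right].
  by case=> c Fv _; move: vs; rewrite hs // Fv.
(* The induction runs over the terms at [x^N] that fail at [tau], and only these are listed;
   elimination may enlarge the rest of the support. *)
have {}hC : forall v, (exists2 c, F v = Some c & v i0 = N /\ c + tau <= a) -> v \in s.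
  by move=> v h; case: (hC v).
elim: s {hs} F JF Fu hF hC => [|x s IH] F JF Fu hF hC.
  exists F => //; exists a => // v c vu Fv; rewrite /om (indnN uN).
  have := hF v c vu Fv.
  have [vN|vN] := eqVneq (v i0) N; last by rewrite indnN // !mulr0.
  rewrite (indN vN) => _; rewrite ltNge; apply/negP => h.
  suff : v \in [::] by [].
  by apply: hC; exists c => //; split=> //; lra.
have [[c Fx [xN low]]|nlow] := pselect (exists2 c, F x = Some c & x i0 = N /\ c + tau <= a);
  last first.
  apply: (IH F) => // v lv; have := hC v lv; rewrite inE => /orP[/eqP E|//].
  by case: nlow; rewrite -E.
pose v := x - v0.
have vi0 : v i0 = 0 by rewrite !ffunE xN v0N subrr.
pose G' := fun y => G (y - v).
have JG' : J G' by apply: Jm.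
have G'x : G' x = Some b by rewrite /G' /v opprB addrC subrK.
(* Minimality of [u] at [tau + e'] gives [c + tau > a - e'], and the gap [e] of [G] exceeds [e']; so
   every term brought in outweighs [a] already at [tau]. *)
have hG' y d : y != x -> G' y = Some d -> a < d + (c - b) + tau * ind y.
  move=> yx G'y.
  have yv : y - v != v0 by rewrite subr_eq /v addrC subrK.
  have := hG _ _ yv G'y.
  have -> : ind (y - v) = ind y by rewrite /ind expoBE vi0 subr0.
  have xu : x != u by apply: contraNneq uN => <-; rewrite xN.
  have := hF x c xu Fx; rewrite (indN xN); lra.
have [H [JH Hx H1 H2]] := eliminate Je Js JF JG' Fx G'x.
apply: (IH H) => //.
- apply: H2 => // c' G'u.
  have ux : u != x by apply: contraNneq uN => ->; rewrite xN.
  by have := hG' u c' ux G'u; rewrite indnN //; lra.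
- move=> y d yu Hy; case: (H1 y d Hy) => -[d' Ed hd].
    by have := hF y d' yu Ed; lra.
  have yx : y != x by apply: contraPneq Hy => ->; rewrite Hx.
  have := hG' y d' yx Ed.
  have : 0 <= e' * ind y by rewrite mulr_ge0 // ler0n.
  by lra.
- move=> y [d Hy [yN lowy]].
  have yx : y != x by apply: contraPneq Hy => ->; rewrite Hx.
  case: (H1 y d Hy) => -[d' Ed hd].
    have : y \in x :: s by apply: hC; exists d' => //; split=> //; lra.
    by rewrite inE (negbTE yx).
  by have := hG' y d' yx Ed; rewrite indN //; lra.
Qed.

(* The parameters [t] at which some member of [J] has a unique minimum off
   [x^N] form an open ray.  If it had an infimum, the member with a unique
   minimum there would have it at [x^N] and [uniq_min_lower] would apply; so
   [t] can tend to [-oo], and the terms in [x^N] must disappear. *)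
Lemma linear_step :
  (exists F u, [/\ J F, u i0 != N & exists2 a, F u = Some a &
     forall v c, v != u -> v i0 != N -> F v = Some c -> a < c]) ->
  (forall t, exists F u, J F /\ uniq_min (om t) F u) ->
  exists F u, [/\ J F, forall v, v i0 = N -> F v = None & uniq_min (fun=> 0) F u].
Proof.
move=> [F0 [u0 [JF0 u0N [a0 F0u0 hF0]]]] hall.
pose Up t := exists F u, [/\ J F, u i0 != N & uniq_min (om t) F u].
have up_closed t t' : t <= t' -> Up t -> Up t'.
  move=> tt' [F [u [JF uN [a Fu h]]]]; exists F, u; split=> //; exists a => // v c vu Fv.
  have := h v c vu Fv; rewrite /om (indnN uN) !mulr0 => lt.
  apply: lt_le_trans lt _; rewrite lerD2l ler_wpM2r // ler0n.
have up_open t : Up t -> exists2 e, 0 < e & Up (t - e).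
  move=> [F [u [JF uN bF]]].
  have [a Fu [e e0 he]] := uniq_min_gap Jf JF bF; exists (e / 2); first by lra.
  exists F, u; split=> //; exists a => // v c vu Fv.
  have := he v c vu Fv; rewrite /om (indnN uN).
  have [vN|vN] := eqVneq (v i0) N; [rewrite (indN vN)|rewrite (indnN vN)]; lra.
have up_ex : exists t, Up t.
  have [s hs] := Jf JF0.
  have [||t ht] := @list_bound R _ s (fun v t => v i0 = N -> forall c, F0 v = Some c -> a0 < c + t).
  - by move=> v t t' tt' h vN c Fv; have := h vN c Fv; lra.
  - move=> v _; case Fv: (F0 v) => [c|]; last by exists 0.
    by exists (a0 - c + 1) => _ c' [<-]; lra.
  exists t, F0, u0; split=> //; exists a0 => // v c vu Fv; rewrite /om (indnN u0N).
  have [vN|vN] := eqVneq (v i0) N; [rewrite (indN vN)|rewrite (indnN vN)].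
    have := ht v (hs v ltac:(by rewrite Fv)) vN c Fv; lra.
  have := hF0 v c vu vN Fv; lra.
have up_all t : Up t.
  apply: contrapT => nUp.
  have lbU : classical_sets.lbound Up t.
    by move=> t' Ut'; rewrite leNgt; apply/negP => /ltW tt'; apply: nUp; apply: up_closed Ut'.
  have hinf : classical_sets.has_inf Up by split=> //; exists t.
  pose tau := inf Up.
  have tauP : ~ Up tau.
    move=> /up_open [e e0 Ue].
    by have := ge_inf (ex_intro _ t lbU) Ue; rewrite -/tau; lra.
  have [G [v [JG bG]]] := hall tau.
  have vN : v i0 = N by apply/eqP/negPn/negP => vN; apply: tauP; exists G, v.
  have [b Gv [e e0 he]] := uniq_min_gap Jf JG bG.
  have [t' [F [u [JF uN bF]]] t'e] := inf_adherent e0 hinf.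
  have taut' : tau <= t' by apply: (ge_inf (ex_intro _ t lbU)); exists F, u.
  have [|||F' JF' bF'] := @uniq_min_lower F G u v e tau (t' - tau) JF JG uN vN.
  - by rewrite -/tau in t'e; apply/andP; split; lra.
  - by exists b.
  - by rewrite addrC subrK.
  - by apply: tauP; exists F', u.
(* Stabilisation along [- ind], that is for parameters tending to [-oo], with every coordinate but
   [i0] free to shift. *)
have [|||X hX] := @eventually_uniq_min R k (fun i => i != i0) L (fun u => - ind u) J Je Js Jf.
- by move=> F v hv JF; apply: Jm => //; apply: hv; rewrite negbK.
- move=> v hv; exists 0 => u; rewrite /ind !ffunE (hv i0) ?negbK //.
  by rewrite !addr0.
- by move=> F u i JF Fu; rewrite negbK => /eqP->; apply: JL JF Fu.
have [F [u [JF uN bF]]] := up_all (- X).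
have [|F' [u' [JF' u'N hF']]] := hX X (lexx X) F u JF.
  by apply: eq_uniq_min bF => v; rewrite /om mulNr mulrN.
have {}u'N : u' i0 != N by rewrite u'N ?negbK.
have [a F'u' _] := hF' X (lexx _).
exists F', u'; split=> //.
- move=> v vN; case F'v: (F' v) => [c|] //.
  have vu' : v != u' by apply: contraNneq u'N => <-; rewrite vN.
  (* At a parameter [t >= c - a] a term of coefficient [c] at [x^N] would weigh at most [a]. *)
  have Xm : X <= Num.max X (c - a) by rewrite le_max lexx.
  have [a' ] := hF' _ Xm; rewrite F'u' => -[<-] /(_ v c vu' F'v).
  rewrite (indnN u'N) (indN vN).
  have : c - a <= Num.max X (c - a) by rewrite le_max lexx orbT.
  move=> h1 h2; have : c - a < c - a by clear F'v F'u'; lra.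
  by rewrite ltxx.
- exists a => // v c vu' F'v /=.
  have [a' ] := hF' X (lexx _); rewrite F'u' => -[<-] /(_ v c vu' F'v).
  rewrite (indnN u'N).
  have [vN|vN] := eqVneq (v i0) N; last by rewrite (indnN vN); lra.
  rewrite (indN vN).
  have Xm : X <= Num.max X (c - a) by rewrite le_max lexx.
  have [a'' ] := hF' _ Xm; rewrite F'u' => -[<-] /(_ v c vu' F'v).
  rewrite (indnN u'N) (indN vN).
  have : c - a <= Num.max X (c - a) by rewrite le_max lexx orbT.
  by lra.
Qed.

End LinearStep.

(** * Functionals on the powers of the eliminated variable *)

Section Fibre.
Variables (R : realType) (k : nat).
Implicit Types (f F G H : expo k -> option R) (u v : expo k).

Definition shift_closed (I : (expo k -> option R) -> Prop) :=
  forall f c v, I f -> I (fun u => tplus (Some c) (f (u - v))).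

Variables (I : (expo k -> option R) -> Prop).
Hypothesis If : fin_closed I.
Hypothesis Ie : elim_closed I.
Hypothesis Ish : shift_closed I.

Variables (i0 : 'I_k) (W : expo k -> R).
Hypothesis WD : forall u v, W (u + v) = W u + W v.

Let WB u v : W (u - v) = W u - W v.
Proof. by have := WD (u - v) v; rewrite subrK; lra. Qed.

Definition weighted (zeta : int -> option R) f u :=
  tplus (f u) (tplus (zeta (u i0)) (Some (W u))).

Lemma weightedP zeta f u c : weighted zeta f u = Some c <->
  exists a z, [/\ f u = Some a, zeta (u i0) = Some z & c = a + (z + W u)].
Proof.
rewrite /weighted; split.
  by case: (f u) => [a|] //; case: (zeta _) => [z|] //= [<-]; exists a, z.
by move=> [a [z [-> -> ->]]].
Qed.

Definition weighted_family zeta (S : pred int) G :=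
  exists f, [/\ I f, forall u, f u <> None -> S (u i0) & G = weighted zeta f].

Lemma weighted_fin zeta S : fin_closed (weighted_family zeta S).
Proof.
move=> _ [f [/If [s hs] _ ->]]; exists s => u h; apply: hs => fu.
by rewrite /weighted fu in h.
Qed.

Lemma weighted_scale zeta S : scale_closed (weighted_family zeta S).
Proof.
move=> _ c [f [fI fS ->]]; exists (fun u => tplus (Some c) (f (u - 0))); split.
- exact: Ish.
- by move=> u; rewrite subr0 => h; apply: fS => fu; rewrite fu in h.
- apply/funext => u; rewrite /weighted subr0.
  by case: (f u) (zeta (u i0)) => [?|] [?|] //=; rewrite addrA.
Qed.

Lemma weighted_elim zeta S : elim_closed (weighted_family zeta S).
Proof.
move=> _ _ u [f [fI fS ->]] [g [gI gS ->]].
move=> E NE.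
have fu : f u <> None by move=> fu; apply: NE; rewrite /weighted fu.
have fgu : f u = g u.
  move: E NE; rewrite /weighted.
  by case: (f u) (g u) (zeta (u i0)) => [a|] [b|] [z|] //= [] /addIr ->.
have [h [hI hu hv]] := Ie fI gI fgu fu.
exists (weighted zeta h); split; [exists h; split=> //| |].
- move=> v hvn; have [+ _] := hv v.
  case Ef: (f v) => [?|]; first by move=> _; apply: fS; rewrite Ef.
  case Eg: (g v) => [?|]; first by move=> _; apply: gS; rewrite Eg.
  by case: (h v) hvn.
- by rewrite /weighted hu.
- move=> v; have [h1 h2] := hv v; rewrite /weighted.
  case: (zeta (v i0)) => [z|] /=; last first.
    by case: (f v) (g v) (h v) => [?|] [?|] [?|].
  have tminD (a b : option R) (d : R) :
      tplus (tmin a b) (Some d) = tmin (tplus a (Some d)) (tplus b (Some d)).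
    by case: a b => [?|] [?|] //=; rewrite addr_minl.
  rewrite -tminD; split.
    by case: (tmin _ _) (h v) h1 => [?|] [?|] //=; rewrite lerD2r.
  by move=> ne; rewrite h2 // => E'; apply: ne; rewrite E'.
Qed.

Lemma weighted_shift (zeta : int -> option R) (S : pred int) F v : (forall j, zeta (j - v i0) = zeta j) ->
  (forall j, S (j - v i0) -> S j) ->
  weighted_family zeta S F -> weighted_family zeta S (fun u => F (u - v)).
Proof.
move=> hz hS [f [fI fS ->]]; exists (fun u => tplus (Some (- W v)) (f (u - v))); split.
- exact: Ish.
- move=> u h; apply: hS; rewrite -expoBE; by apply: fS => fu; apply: h; rewrite fu.
- apply/funext => u; rewrite /weighted expoBE hz WB.
  by case: (f _) (zeta (u i0)) => [?|] [?|] //=; congr Some; ring.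
Qed.

Hypothesis fibre0 : forall f, I f -> (forall u, f u <> None -> u i0 = 0) ->
  forall u, ~ uniq_min W f u.

(* A functional on the powers of the eliminated variable which is orthogonal
   to the members of [I] of bounded degree; its values are chosen one at a
   time. *)
Lemma exists_functional (s : seq int) : exists2 zeta : int -> option R, zeta 0 = Some 0 &
  forall f, I f -> (forall u, f u <> None -> u i0 \in 0 :: s) ->
    forall u, ~ uniq_min (fun=> 0) (weighted zeta f) u.
Proof.
elim: s => [|N s [zeta z0 hz]].
  exists (fun=> Some 0) => // f fI fS u [_ /weightedP[a [z [fu [<-] ->]]] h].
  have fS0 v : f v <> None -> v i0 = 0 by move=> /fS; rewrite inE => /eqP.
  apply: (fibre0 fI fS0); exists a; first exact: fu.
  move=> v c vu fv; have := h v (c + (0 + W v)) vu.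
  rewrite /weighted fv => /(_ erefl); lra.
have [Ns|Ns] := boolP (N \in 0 :: s).
  exists zeta => // f fI fS; apply: hz => // u /fS; rewrite !inE in Ns *.
  by case/or3P=> [->//|/eqP->//|->]; rewrite orbT.
pose S := [pred j | j \in 0 :: N :: s].
pose ext t : int -> option R := fun j => if j == N then t else zeta j.
have N0 : N != 0 by apply: contraNneq Ns => ->; rewrite inE eqxx.
have ext0 t : ext t 0 = Some 0 by rewrite /ext eq_sym (negbTE N0).
have bad t : (forall f, I f -> (forall u, f u <> None -> u i0 \in 0 :: N :: s) ->
    forall u, ~ uniq_min (fun=> 0) (weighted (ext t) f) u) \/
  exists f u, [/\ I f, forall u, f u <> None -> u i0 \in 0 :: N :: s &
    uniq_min (fun=> 0) (weighted (ext t) f) u].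
  apply/or_asboolP; case: asboolP => //= nh; apply/asboolP.
  apply: contrapT => ne; apply: nh => f fI fS u hu; apply: ne; by exists f, u.
(* The value [None] is tried first. If it fails, the culprit [f0] has a unique minimum among its
   terms off [x^N], as [linear_step] asks. *)
case: (bad None) => [h|[f0 [u0 [f0I f0S [a0 Fu0 h0]]]]].
  by exists (ext None).
apply: contrapT => nex.
have hall t : exists f u, [/\ I f, forall u, f u <> None -> u i0 \in 0 :: N :: s &
    uniq_min (fun=> 0) (weighted (ext (Some t)) f) u].
  case: (bad (Some t)) => // h; case: nex; by exists (ext (Some t)).
have extS t f v : weighted (ext (Some t)) f v =
    tplus (weighted (ext (Some 0)) f v) (Some (t * (v i0 == N)%:R)).
  rewrite /weighted /ext; case: (f v) => [a|] //; case: (v i0 == N) => /=.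
    by congr Some; ring.
  by case: (zeta _) => [?|] //=; congr Some; ring.
have bs : exists L : nat, forall j, j \in 0 :: N :: s -> (`|j| <= L)%N.
  elim: (0 :: N :: s) => [|j l [L hL]]; first by exists 0%N.
  exists (maxn `|j| L) => j'; rewrite inE leq_max => /orP[/eqP->|/hL->].
    by rewrite leqnn.
  by rewrite orbT.
case: bs => L hL.
have [||||F [u [[f [fI fS ->]] FN bF]]] := @linear_step R k i0 L N (weighted_family (ext (Some 0)) S)
  (@weighted_elim _ _) (@weighted_scale _ _) (@weighted_fin _ _).
- move=> F v v0; apply: weighted_shift => j; by rewrite v0 subr0.
- move=> _ u [f [fI fS ->]] Fu; apply: hL; apply: fS => fu; by rewrite /weighted fu in Fu.
- have u0N : u0 i0 != N.
    have /weightedP[a [z [_ + _]]] := Fu0.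
    by rewrite /ext; case: (u0 i0 == N).
  have extE v : v i0 != N -> weighted (ext (Some 0)) f0 v = weighted (ext None) f0 v.
    by move=> vN; rewrite /weighted /ext (negbTE vN).
  exists (weighted (ext (Some 0)) f0), u0; split=> //; first by exists f0.
  exists a0; first by rewrite extE.
  by move=> v c vu vN; rewrite extE // => Fv; have := h0 v c vu Fv; rewrite !addr0.
- move=> t; have [f [u [fI fS [a Fu h]]]] := hall t.
  exists (weighted (ext (Some 0)) f), u; split; first by exists f.
  move: Fu; rewrite extS; case Fu: (weighted _ f u) => [b|] //= -[E].
  exists b => // v c vu Fv.
  have := h v (c + t * (v i0 == N)%:R) vu; rewrite extS Fv => /(_ erefl).
  by rewrite !addr0 -E.
(* By [FN] no term at [x^N] is left, the value there being finite; so [f] already contradicts the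
   previous functional [zeta]. *)
apply: (hz f fI _ u).
  move=> v fv; have := fS v fv; rewrite /S !inE => /or3P[->//|/eqP vN|->]; last first.
    by rewrite orbT.
  have := FN v vN; rewrite /weighted /ext vN eqxx.
  by case: (f v) fv.
have noN v : v i0 = N -> f v = None.
  by move=> vN; have := FN v vN; rewrite /weighted /ext vN eqxx; case: (f v).
have extE : weighted (ext (Some 0)) f = weighted zeta f.
  apply/funext => v; rewrite /weighted /ext; case: eqP => // /noN ->//.
by rewrite -extE.
Qed.

End Fibre.

(** * Uniform constants on a compact interval *)

Section Compactness.

(** If uniform constants failed on the whole interval, the right ends up to which they exist would
    have a supremum; the local constants there, merged with earlier ones by [mon], push past it. *)
Lemma uniform_on_interval (R : realType) (P : R -> R -> nat -> Prop) (a b : R) :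
  (forall x e D e' D', e' <= e -> (D <= D')%N -> P x e D -> P x e' D') ->
  (forall x, exists d e D, [/\ 0 < d, 0 < e & forall y, `|y - x| < d -> P y e D]) ->
  exists e D, 0 < e /\ forall x, a <= x <= b -> P x e D.
Proof.
move=> mon loc.
pose Q c := exists e D, 0 < e /\ forall x, a <= x <= c -> P x e D.
apply: contrapT => nQ.
pose E : R -> Prop := fun c => a <= c /\ Q c.
have Ea : E a.
  split=> //; have [d [e [D [d0 e0 h]]]] := loc a; exists e, D; split=> // x xa.
  have -> : x = a by apply/eqP; rewrite eq_le andbC.
  by apply: h; rewrite subrr normr0.
have ubE : classical_sets.ubound E b.
  move=> c [ac [e [D [e0 h]]]]; rewrite leNgt; apply/negP => bc.
  apply: nQ; exists e, D; split=> // x /andP[ax xb]; apply: h.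
  by apply/andP; split; lra.
have hsup : classical_sets.has_sup E by split; [exists a|exists b].
have ub := sup_upper_bound hsup.
have [d [e [D [d0 e0 h]]]] := loc (sup E).
have [c [ac [e' [D' [e'0 h']]]] cs] := sup_adherent d0 hsup.
have sa : a <= sup E := ub _ Ea.
suff /ub : E (sup E + d / 2) by lra.
split; first by lra.
exists (Num.min e e'), (maxn D D'); split; first by rewrite lt_min e0.
move=> x /andP[ax xs]; have [xc|cx] := lerP x c.
  by apply: (mon x e' D'); rewrite ?ge_min ?leq_max ?lexx ?leqnn ?orbT //; apply: h'; rewrite ax.
apply: (mon x e D); rewrite ?ge_min ?leq_max ?lexx ?leqnn //; apply: h.
by rewrite ltr_norml; apply/andP; split; lra.
Qed.

End Compactness.

(** * Lifting a point along one variable *)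

Section OneVariable.
Variables (R : realType) (k : nat).
Implicit Types (f F G H : expo k -> option R) (u v : expo k).

Variables (I : (expo k -> option R) -> Prop).
Hypothesis If : fin_closed I.
Hypothesis Ie : elim_closed I.
Hypothesis Ish : shift_closed I.

Variables (i0 : 'I_k) (W : expo k -> R).
Hypothesis WD : forall u v, W (u + v) = W u + W v.
Hypothesis fibre0 : forall f, I f -> (forall u, f u <> None -> u i0 = 0) ->
  forall u, ~ uniq_min W f u.

Let p u : R := (u i0)%:~R.
Let J := weighted_family I i0 W (fun=> Some 0) predT.

Let pD u v : p (u + v) = p u + p v.
Proof. by rewrite /p ffunE intrD. Qed.

Let p0 : p 0 = 0.
Proof. by rewrite /p ffunE. Qed.

Let Jf : fin_closed J := @weighted_fin R k I If i0 W _ _.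
Let Je : elim_closed J := @weighted_elim R k I Ie i0 W _ _.
Let Js : scale_closed J := @weighted_scale R k I Ish i0 W _ _.
Let Jm F v : J F -> J (fun u => F (u - v)).
Proof. exact: weighted_shift. Qed.

Let degree_bound F : J F -> exists D : nat, forall v, F v <> None -> (`|v i0| <= D)%N.
Proof.
move=> /Jf[s hs]; have [D hD] := expo_bound s.
by exists D => v /hs /hD.
Qed.

(* Translating the minimal term to the constant term [0]. *)
Let normalize F u a : J F -> F u = Some a -> exists G, [/\ J G, G 0 = Some 0 &
  forall om v c, (forall x y : expo k, om (x + y) = om x + om y) -> uniq_min om F u ->
     v != 0 -> G v = Some c -> 0 < c + om v].
Proof.
move=> JF Fu; exists (fun v => tplus (Some (- a)) (F (v - - u))); split.
- by apply: Js; apply: Jm.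
- by rewrite sub0r opprK Fu /= addNr.
move=> om v c omD [a' Fu' h] v0; rewrite opprK.
move: Fu' h; rewrite Fu => -[<-] h.
case Fv: (F (v + u)) => [d|] //= -[<-].
have vu : v + u != u by rewrite -subr_eq0 addrK.
by have := h _ _ vu Fv; rewrite omD; lra.
Qed.

Let eventually (sg : R) : (forall t, exists F u, J F /\ uniq_min (fun v => t * p v) F u) ->
  exists X D G, [/\ J G, G 0 = Some 0 & forall v c, v != 0 -> G v = Some c ->
    (`|v i0| <= D)%N /\ forall t, X <= t -> 0 < c + t * sg * p v].
Proof.
move=> hall.
have [|||X hX] := @eventually_uniq_min R k predT 0 (fun u => sg * p u) J Je Js Jf.
- by move=> F v _; apply: Jm.
- by move=> v _; exists (sg * p v) => u; rewrite pD mulrDr.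
- by [].
have [F [u [JF bF]]] := hall (X * sg).
have [|F' [u' [JF' _ hF']]] := hX X (lexx _) F u JF.
  by apply: eq_uniq_min bF => v; rewrite mulrA.
have [a F'u' _] := hF' X (lexx _).
have [G [JG G0 hG]] := normalize JF' F'u'.
have [D hD] := degree_bound JG.
exists X, D, G; split=> // v c v0 Gv; split; first by apply: hD; rewrite Gv.
move=> t Xt; have := hG (fun v => t * (sg * p v)) v c _ (hF' t Xt) v0 Gv.
by rewrite mulrA; apply=> x y /=; rewrite pD; ring.
Qed.

Let uniform (X : R) : (forall t, exists F u, J F /\ uniq_min (fun v => t * p v) F u) ->
  exists e D, 0 < e /\ forall x, - X <= x <= X ->
   exists G, [/\ J G, G 0 = Some 0 & forall v c, v != 0 -> G v = Some c ->
    (`|v i0| <= D)%N /\ e <= c + x * p v].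
Proof.
move=> hall; apply: (@uniform_on_interval R (fun x e D =>
   exists G, [/\ J G, G 0 = Some 0 & forall v c, v != 0 -> G v = Some c ->
    (`|v i0| <= D)%N /\ e <= c + x * p v])).
  move=> x e D e' D' ee DD [G [JG G0 hG]]; exists G; split=> // v c v0 Gv.
  have [h1 h2] := hG v c v0 Gv; split; [exact: leq_trans h1 DD|exact: le_trans ee h2].
move=> x; have [F [u [JF bF]]] := hall x.
have [a Fu _] := bF.
have [G [JG G0 hG]] := normalize JF Fu.
have bG : uniq_min (fun v => x * p v) G 0.
  exists 0 => // v c v0 Gv; have := hG _ v c _ bF v0 Gv.
  rewrite p0 mulr0 addr0; apply=> y z /=.
  by rewrite pD mulrDr.
have [a0 + [e e0 he]] := uniq_min_gap Jf JG bG.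
rewrite G0 => -[E]; subst a0.
have [D hD] := degree_bound JG.
have D1 : (0 : R) < D.+1%:R by rewrite ltr0n.
(* Exponents are bounded by [D], so changing the slope by less than this radius alters a term by at
   most half of the gap [e]; the divisor [D.+1] is never zero. *)
exists (e / 2 / D.+1%:R), (e / 2), D; split; [by rewrite divr_gt0 //; lra|lra|].
move=> y; rewrite ltr_pdivlMr // => yx; exists G; split=> // v c v0 Gv.
have Dv : (`|v i0| <= D)%N by apply: hD; rewrite Gv.
split=> //; have := he v c v0 Gv; rewrite p0 mulr0 !add0r.
have : `|(y - x) * p v| <= e / 2.
  apply: le_trans (ltW yx); rewrite normrM ler_wpM2l //.
  rewrite /p -intr_norm -abszE -[_%:~R]/(_%:R) ler_nat; exact: leqW.
by rewrite ler_norml => /andP[]; rewrite mulrBl; lra.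
Qed.

(* [zeta + kap j^2] is minimised over [-L, L] at some [j], and near [j] the
   parabola is almost linear of slope [-2 kap j], which contradicts the
   existence of members of [I] having a unique minimum at that slope. *)
Lemma no_parabola (kap : R) (L : nat) :
  (forall j : int, `|j| <= L%:Z -> exists G, [/\ J G, G 0 = Some 0 &
     forall v c, v != 0 -> G v = Some c ->
      `|j + v i0| <= L%:Z /\ kap * p v ^+ 2 < c - 2 * kap * j%:~R * p v]) -> False.
Proof.
move=> hG.
pose s : seq int := [seq (i : nat)%:Z - L%:Z | i <- iota 0 (L + L).+1].
have sP j : (j \in s) = (`|j| <= L%:Z).
  apply/mapP/idP => [[i]|h]; first by rewrite mem_iota => ? ->; lia.
  by exists (absz (j + L%:Z)); [rewrite mem_iota|]; lia.
have s0P j : (j \in 0 :: s) = (`|j| <= L%:Z).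
  by rewrite inE sP; case: eqP => [->|//]; lia.
have [zeta z0 hz] := exists_functional If Ie Ish WD fibre0 s.
pose val j := odflt 0 (zeta j) + kap * j%:~R ^+ 2.
have [|||j js hj] := @exists_least int (fun j j' => val j <= val j')
    [seq j <- 0 :: s | zeta j != None].
- by move=> x y z; apply: le_trans.
- by move=> x y _; apply/orP; apply: le_total.
- by rewrite /= z0.
move: js; rewrite mem_filter s0P => /andP[zj jL].
have [G [[f [fI _ EG]] G0 hGj]] := hG j jL.
case Ez: (zeta j) zj => [z|] // _.
(* Multiplying by [x^j] moves the constant term of [G] to the minimiser [j]. *)
pose v0 : expo k := [ffun i => if i == i0 then j else 0].
have v0i : v0 i0 = j by rewrite ffunE eqxx.
pose f' u := tplus (Some 0) (f (u - v0)).
have f'I : I f' by exact: Ish.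
have f'N u : f' u <> None -> f (u - v0) <> None by rewrite /f'; case: (f _).
have WS u : W u = W (u - v0) + W v0 by rewrite -WD subrK.
have supp u : f (u - v0) <> None -> `|u i0| <= L%:Z.
  have [->|uv0 fu] := eqVneq u v0; first by rewrite v0i.
  have uv : u - v0 != 0 by rewrite subr_eq0.
  case E: (f _) fu => [b|] // _.
  have Gu : G (u - v0) = Some (b + (0 + W (u - v0))) by rewrite EG /weighted E.
  by have [+ _] := hGj _ _ uv Gu; rewrite expoBE v0i addrC subrK.
apply: (hz f' f'I _ v0) => [u /f'N/supp|]; first by rewrite s0P.
move: G0; rewrite EG => /weightedP[a [_ [f0 [<-] Ea]]].
exists (a + (z + W v0)); first by rewrite /weighted /f' subrr f0 v0i Ez /= add0r.
move=> u c uv0 /weightedP[b' [z' [f'u zu Ec]]].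
have uv : u - v0 != 0 by rewrite subr_eq0.
move: f'u; rewrite /f'; case fu: (f (u - v0)) => [b|] //= -[]; rewrite add0r => Eb; subst b'.
have Gu : G (u - v0) = Some (b + (0 + W (u - v0))) by rewrite EG /weighted fu.
have [_ +] := hGj _ _ uv Gu.
have uL : u i0 \in [seq j <- 0 :: s | zeta j != None].
  by rewrite mem_filter zu s0P supp // fu.
have vj : val j <= val (u i0).
  by have [->//|ne] := eqVneq (u i0) j; apply: hj.
(* With [q = u i0 - j], minimality of [j] gives [z' - z >= - kap * (2 * j * q + q ^ 2)], which the
   assumed bound on [G] exactly beats. *)
move: vj; rewrite /val Ez zu /= /p expoBE v0i intrB Ec (WS u).
move: (_%:~R) => P h1; move: h1; move: (_%:~R) => Q.
have W00 : W 0 = 0 by have := WD 0 0; rewrite addr0; lra.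
rewrite W00 in Ea.
by lra.
Qed.

Lemma ler_abs_add_opp (D : nat) (x y : int) : x <= 0 -> 0 <= y ->
  `|x| <= D%:Z -> `|y| <= D%:Z -> `|x + y| <= D%:Z.
Proof. lia. Qed.

Lemma exists_point : exists x, forall f, I f ->
  forall u, ~ uniq_min (fun v => x * p v + W v) f u.
Proof.
apply: contrapT => nx.
have hall t : exists F u, J F /\ uniq_min (fun v => t * p v) F u.
  apply: contrapT => nt; apply: nx; exists t => f fI u [a fu h].
  apply: nt; exists (weighted i0 W (fun=> Some 0) f), u; split; first by exists f.
  exists (a + (0 + W u)); first by rewrite /weighted fu.
  move=> v c vu /weightedP[b [_ [fv [<-] ->]]].
  by have := h v b vu fv; lra.
have [X1 [D1 [G1 [JG1 G10 hG1]]]] := eventually 1 hall.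
have [X2 [D2 [G2 [JG2 G20 hG2]]]] := eventually (-1) hall.
pose X := Num.max 0 (Num.max X1 X2).
have X0 : 0 <= X by rewrite le_max lexx.
have XX1 : X1 <= X by rewrite !le_max lexx orbT.
have XX2 : X2 <= X by rewrite !le_max lexx !orbT.
have [e [D3 [e0 hun]]] := uniform (X + 1) hall.
pose D := (D1 + D2 + D3).+1.
have DD1 : (D1 <= D)%N by rewrite /D -addnA leqW ?leq_addr.
have DD2 : (D2 <= D)%N by rewrite /D addnAC leqW ?leq_addl.
have DD3 : (D3 <= D)%N by rewrite /D leqW ?leq_addl.
pose d : R := D%:R.
have d1 : 1 <= d by rewrite ler1n.
(* Chosen so that [kap * d ^ 2 < e], the gap for moderate slopes, and [kap * d <= 1], which serves
   for steep ones. *)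
pose kap := Num.min (e / 2) 1 / d ^+ 2.
have m0 : 0 < Num.min (e / 2) 1 by rewrite lt_min; apply/andP; split; lra.
have d20 : 0 < d ^+ 2 by rewrite exprn_gt0 //; lra.
have kap0 : 0 < kap by rewrite divr_gt0.
have kapd2 : kap * d ^+ 2 = Num.min (e / 2) 1 by rewrite divfK // gt_eqF.
have kapd2e : kap * d ^+ 2 < e.
  by rewrite kapd2 gt_min; apply/orP; left; lra.
have kapd : kap * d <= 1.
  apply: (@le_trans _ _ (kap * d ^+ 2)); last by rewrite kapd2 ge_min lexx orbT.
  by rewrite ler_wpM2l ?(ltW kap0) // expr2 ler_peMr //; lra.
(* The slope [- 2 * kap * j] stays within [X + 1] exactly when [|j| <= M]; the extra [D] in [L]
   leaves room for the exponents of [G]. *)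
pose M := (X + 1) / (2 * kap).
have M0 : 0 <= M by rewrite divr_ge0 //; lra.
have ME : M * (2 * kap) = X + 1 by rewrite divfK // gt_eqF //; lra.
pose L := (Num.bound M + D)%N.
have LM : M + d < L%:R.
  by rewrite natrD ltrD2r archi_boundP.
have DL : (D <= L)%N by rewrite leq_addl.
apply: (@no_parabola kap L) => j jL.
pose x := - (2 * kap * j%:~R).
have jE : j%:~R * (2 * kap) = - x by rewrite /x; ring.
have pd v : (`|v i0| <= D)%N -> `|p v| <= d.
  by move=> h; rewrite /p -intr_norm -abszE -[_%:~R]/(_%:R) ler_nat.
have kp v : (`|v i0| <= D)%N -> kap * p v ^+ 2 <= kap * d ^+ 2.
  move=> h; rewrite ler_wpM2l ?(ltW kap0) // -[p v ^+ 2]real_normK ?num_real //.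
  by rewrite lerXn2r ?nnegrE ?normr_ge0 ?pd //; lra.
have [hx|hx] := leP (X + 1) x.
- have j0 : j <= 0.
    rewrite -(ler_int R) -(pmulr_lle0 _ (_ : 0 < 2 * kap)) ?jE; lra.
  exists G1; split=> // v c v0 Gv; have [vD hv] := hG1 v c v0 Gv.
  have vD' := leq_trans vD DD1.
  (* A negative exponent would make the term negative at large slopes. As [j <= 0], adding an
     exponent between 0 and [D] cannot leave [[-L, L]]. *)
  have v0' : 0 <= p v.
    rewrite leNgt; apply/negP => pv.
    have := hv (Num.max X1 (- c / p v)).
    rewrite le_max lexx mulr1 => /(_ isT).
    have : - c / p v <= Num.max X1 (- c / p v) by rewrite le_max lexx orbT.
    rewrite ler_ndivrMr //; lra.
  split; first by move: v0'; rewrite /p ler0z => ?; apply: ler_abs_add_opp => //;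
    rewrite -abszE lez_nat (leq_trans vD' DL).
  have := hv X XX1; rewrite mulr1 => hX.
  have pvd : p v <= d by have := pd v vD'; rewrite ger0_norm.
  (* The unit of slope beyond [X] pays for the quadratic term. *)
  have h1 : (kap * p v) * p v <= 1 * p v.
    rewrite ler_wpM2r //; apply: le_trans kapd; rewrite ler_wpM2l //; lra.
  have h2 : (X + 1) * p v <= x * p v by rewrite ler_wpM2r.
  by rewrite /x in h2; lra.
have [hx'|hx'] := leP x (- (X + 1)).
- have j0 : 0 <= j.
    rewrite -(ler_int R) -(pmulr_lge0 _ (_ : 0 < 2 * kap)) ?jE; lra.
  exists G2; split=> // v c v0 Gv; have [vD hv] := hG2 v c v0 Gv.
  have vD' := leq_trans vD DD2.
  have v0' : p v <= 0.
    rewrite leNgt; apply/negP => pv.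
    have := hv (Num.max X2 (c / p v)).
    rewrite le_max lexx => /(_ isT).
    have : c / p v <= Num.max X2 (c / p v) by rewrite le_max lexx orbT.
    rewrite ler_pdivrMr //; lra.
  split; first by move: v0'; rewrite /p lerz0 => ?; rewrite addrC; apply: ler_abs_add_opp => //;
    rewrite -abszE lez_nat (leq_trans vD' DL).
  have := hv X XX2 => hX.
  have pvd : - p v <= d by have := pd v vD'; rewrite ler0_norm.
  have h1 : (kap * - p v) * - p v <= 1 * - p v.
    rewrite ler_wpM2r ?oppr_ge0 //; apply: le_trans kapd; rewrite ler_wpM2l //; lra.
  have h2 : (X + 1) * - p v <= - x * - p v by rewrite ler_wpM2r ?oppr_ge0 //; lra.
  by rewrite /x in h2; lra.
(* Moderate slopes: the uniform gap [e] absorbs [kap * p v ^ 2], and [|j| <= M] keeps [j + v i0] in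
   range. *)
have [|G [JG G0 hG]] := hun x; first by apply/andP; split; lra.
exists G; split=> // v c v0 Gv; have [vD hv] := hG v c v0 Gv.
have vD' := leq_trans vD DD3.
split; last by have := kp v vD'; rewrite /x in hv; lra.
have jM : `|j%:~R : R| <= M.
  rewrite -(ler_pM2r (_ : 0 < 2 * kap)) ?ME; last by lra.
  rewrite -[X in _ * X]gtr0_norm -?normrM ?jE ?normrN ?ler_norml; last by lra.
  by apply/andP; split; lra.
have : `|(j + v i0)%:~R : R| <= M + d.
  by rewrite intrD; apply: le_trans (ler_normD _ _) _; apply: lerD => //; apply: pd.
move=> h; have := le_lt_trans h LM.
by rewrite -intr_norm -[L%:R]/(L%:Z%:~R) ltr_int => /ltW.
Qed.

End OneVariable.

(** * Varieties, elimination ideals and induction on the variables *)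

Section Elimination.
Variable R : realType.

(** Finite support provides a lexicographically first minimiser; either it is the only one, or an
    exponent tied with it is the second that [tvar] asks for. *)
Lemma tvarP k (K : tpoly R k -> Prop) (z : 'I_k -> R) : fin_closed K ->
  tvar K z <-> forall f, K f -> forall u, ~ uniq_min (fun v => dotp v z) f u.
Proof.
move=> Kf; split=> [V f Kf' u [a fu h]|V f Kf' [u0 fu0]].
  have [|u' [v' [a' [b' [uv fu' fv' E hmin]]]]] := V f Kf'.
    by exists u; rewrite fu.
  have hu := hmin u a fu.
  have [E'|ne] := eqVneq u' u; last by have := h u' a' ne fu'; lra.
  have v'u : v' != u by rewrite -E' eq_sym.
  by move: fu'; rewrite E' fu => -[Ea]; have := h v' b' v'u fv'; subst; lra.
have [u lu] := exists_leads (@lex_trans k) (@lex_total k) (fun v => dotp v z) Kf Kf' fu0.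
have [a fu hl] := lu.
have [[v [c [vu fv E]]]|nE] := pselect (exists v c, [/\ v != u, f v = Some c &
    a + dotp u z = c + dotp v z]); last first.
  case: (V f Kf' u); exists a => // v c vu fv.
  by case: (hl v c vu fv) => // -[_ E _]; case: nE; exists v, c.
exists u, v, a, c; split=> //; first by rewrite eq_sym.
move=> t d ft; have [E'|tu] := eqVneq t u.
  by move: ft; rewrite E' fu => -[->].
by case: (hl t d tu ft) => [/ltW //|[_ -> _]].
Qed.

(** The form of the hypotheses that passes to elimination ideals, as the induction on the variables
    requires. *)
Definition trop_closed k (I : tpoly R k -> Prop) :=
  [/\ fin_closed I, elim_closed I & shift_closed I].

Lemma tropical_ideal_closed k (I : tpoly R k -> Prop) :
  tropical_ideal I -> trop_closed I.
Proof.
move=> [[If _ _ Imul] Ie]; split=> //.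
move=> f c v fI.
have gs : finsupp_with (fun u => if u == v then Some c else None) [:: v].
  by move=> u; rewrite inE; case: eqP.
have := Imul f _ _ fI gs; congr (I _); apply/funext => u.
rewrite /tmul_with big_cons big_nil eqxx /=.
by case: (f (u - v)).
Qed.

Section Embedding.
Variables n m : nat.
Implicit Types (u : expo m) (v : expo (n + m)).

Definition in_y u : expo (n + m) :=
  [ffun i => match split i with inl _ => 0 | inr j => u j end].
Definition y_part v : expo m := [ffun j => v (rshift n j)].
Definition only_y v := [forall i : 'I_n, v (lshift m i) == 0].

Lemma in_y_lshift u i : in_y u (lshift m i) = 0.
Proof. by rewrite ffunE; case: splitP => // j /= E; have := ltn_ord i; rewrite E; lia. Qed.

Lemma in_y_rshift u j : in_y u (rshift n j) = u j.
Proof.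
rewrite ffunE; case: splitP => i /= E; first by have := ltn_ord i; rewrite -E; lia.
by congr (u _); apply: val_inj => /=; lia.
Qed.

Lemma in_yK u : y_part (in_y u) = u.
Proof. by apply/ffunP => j; rewrite ffunE in_y_rshift. Qed.

Lemma only_y_in_y u : only_y (in_y u).
Proof. by apply/forallP => i; rewrite in_y_lshift. Qed.

Lemma y_partK v : only_y v -> in_y (y_part v) = v.
Proof.
move=> /forallP h; apply/ffunP => i; rewrite -(splitK i).
case: (split i) => j /=; first by rewrite in_y_lshift (eqP (h j)).
by rewrite in_y_rshift ffunE.
Qed.

Lemma only_yB v u : only_y (v - in_y u) = only_y v.
Proof. by apply: eq_forallb => i; rewrite expoBE in_y_lshift subr0. Qed.

Lemma y_partB v u : y_part (v - in_y u) = y_part v - u.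
Proof. by apply/ffunP => j; rewrite !expoBE ffunE expoBE in_y_rshift [y_part v j]ffunE. Qed.

Lemma embedE (g : tpoly R m) v :
  ypoly_embed (n := n) g v = if only_y v then g (y_part v) else None.
Proof. by []. Qed.

Lemma embed_in_y (g : tpoly R m) u : ypoly_embed (n := n) g (in_y u) = g u.
Proof. by rewrite embedE only_y_in_y in_yK. Qed.

Lemma embed_restrict (F : tpoly R (n + m)) :
  (forall v, F v <> None -> only_y v) -> ypoly_embed (n := n) (fun u => F (in_y u)) = F.
Proof.
move=> h; apply/funext => v; rewrite embedE; case: (boolP (only_y v)) => hv.
  by rewrite y_partK.
by case E: (F v) => [a|] //; rewrite h ?E in hv.
Qed.

Lemma embed_only_y (g : tpoly R m) v : ypoly_embed (n := n) g v <> None -> only_y v.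
Proof. by rewrite embedE; case: (only_y v). Qed.

(** The inequality in the elimination axiom confines the new vector to the union of the two
    supports, so it stays a polynomial in [y]. *)
Lemma elim_ideal_closed (I : tpoly R (n + m) -> Prop) :
  trop_closed I -> trop_closed (elim_ideal I).
Proof.
move=> [If Ie Ish]; split.
- move=> g /If[s hs]; exists [seq y_part v | v <- s] => u gu.
  rewrite -(in_yK u) map_f //; apply: hs; by rewrite embed_in_y.
- move=> f g u fI gI fg fu.
  have [||H [HI Hu Hv]] := Ie _ _ (in_y u) fI gI; rewrite ?embed_in_y //.
  exists (fun u => H (in_y u)); split=> //.
    rewrite /elim_ideal embed_restrict // => v Hn; have [+ _] := Hv v.
    rewrite !embedE; case: (only_y v) => //=.
    by case: (H v) Hn.
  by move=> v; have := Hv (in_y v); rewrite !embed_in_y.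
- move=> f c v /(Ish _ c (in_y v)); congr (I _); apply/funext => w.
  by rewrite !embedE only_yB y_partB; case: (only_y w).
Qed.

Lemma dotp_split v (z : 'I_(n + m) -> R) :
  dotp v z = \sum_(i < n) (v (lshift m i))%:~R * z (lshift m i) +
             dotp (y_part v) (proj_y z).
Proof.
rewrite /dotp big_split_ord; congr (_ + _); apply: eq_bigr => j _.
by rewrite ffunE.
Qed.

Lemma dotp_in_y u (z : 'I_(n + m) -> R) : dotp (in_y u) z = dotp u (proj_y z).
Proof.
rewrite dotp_split in_yK big1 ?add0r // => i _.
by rewrite in_y_lshift mul0r.
Qed.

Lemma tvar_proj (I : tpoly R (n + m) -> Prop) z : trop_closed I ->
  tvar I z -> tvar (elim_ideal I) (proj_y z).
Proof.
move=> Ic; have [If _ _] := Ic; have [If' _ _] := elim_ideal_closed Ic.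
move=> /(tvarP _ If) V; apply/(tvarP _ If') => g gI u [a gu h].
apply: (V _ gI (in_y u)); exists a; first by rewrite embed_in_y.
move=> v c vu gv; have hv : only_y v by apply: (@embed_only_y g); rewrite gv.
move: vu gv; rewrite -(y_partK hv) embed_in_y !dotp_in_y => vu gv.
by apply: h => //; apply: contraNneq vu => ->.
Qed.

End Embedding.

Lemma dotpD k (u v : expo k) (z : 'I_k -> R) : dotp (u + v) z = dotp u z + dotp v z.
Proof.
rewrite /dotp -big_split; apply: eq_bigr => i _.
by rewrite ffunE intrD mulrDl.
Qed.

(** Members of [I] of [x]-degree 0 come from the elimination ideal, whose variety contains [w]; this
    gives [fibre0], and [exists_point] supplies the missing coordinate. *)
Lemma tvar_lift1 m (I : tpoly R (1 + m) -> Prop) w : trop_closed I ->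
  tvar (elim_ideal (n := 1) I) w -> exists2 z, tvar I z & proj_y (n := 1) z = w.
Proof.
move=> Ic; have [If Ie Ish] := Ic; have [If' _ _] := elim_ideal_closed Ic.
move=> /(tvarP _ If') V.
pose i0 : 'I_(1 + m) := lshift m ord0.
pose W (v : expo (1 + m)) := dotp (y_part (n := 1) v) w.
have WD u v : W (u + v) = W u + W v.
  by rewrite /W -dotpD; congr dotp; apply/ffunP => j; rewrite !ffunE.
have onlyP (v : expo (1 + m)) : v i0 = 0 -> only_y (n := 1) v.
  by move=> v0; apply/forallP => i; rewrite ord1; apply/eqP.
have [|x hx] := @exists_point R _ I If Ie Ish i0 W WD.
  move=> f fI fS u [a fu h].
  have f_only (v : expo (1 + m)) : f v <> None -> only_y (n := 1) v by move=> /fS /onlyP.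
  have ou : only_y (n := 1) u by apply: f_only; rewrite fu.
  have gI : elim_ideal (n := 1) I (fun u => f (in_y 1 u)).
    by rewrite /elim_ideal embed_restrict.
  apply: (V _ gI (y_part (n := 1) u)); exists a; first by rewrite y_partK.
  move=> v c vu fv; have := h _ c _ fv; rewrite /W in_yK; apply.
  by apply: contraNneq vu => <-; rewrite in_yK.
pose z (i : 'I_(1 + m)) : R := match split i with inl _ => x | inr j => w j end.
have zl : z i0 = x.
  by rewrite /z /i0; case: splitP => // j /= E; have := ltn_ord j; lia.
have zr : proj_y (n := 1) z = w.
  apply/funext => j; rewrite /proj_y /z; case: splitP => i /= E.
    by have := ltn_ord i; rewrite -E; lia.
  by congr (w _); apply: val_inj => /=; lia.
exists z => //; apply/(tvarP _ If) => f fI u hu; apply: (hx f fI u).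
apply: eq_uniq_min hu => v.
by rewrite dotp_split zr big_ord1 -/i0 zl mulrC.
Qed.

(** Lets the variables be eliminated one at a time; the two sides have convertible types, [n.+1 + m]
    and [1 + (n + m)]. *)
Lemma ypoly_embedS n m (g : tpoly R m) :
  ypoly_embed (n := n.+1) g = ypoly_embed (n := 1) (ypoly_embed (n := n) g) :> tpoly R (n.+1 + m).
Proof.
apply/funext => v.
rewrite (embedE (n := 1) (m := n + m)) [LHS]embedE embedE.
have -> : only_y (n := n.+1) v =
    only_y (n := 1) (m := n + m) v && only_y (n := n) (y_part (n := 1) (m := n + m) v).
  apply/forallP/andP => [h|[/forallP h1 /forallP h2] i].
    split; apply/forallP => i.
      by have := h ord0; congr (v _ == _); apply: val_inj; rewrite /= ord1.
    by rewrite ffunE; have := h (lift ord0 i); congr (v _ == _); apply: val_inj.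
  case: (unliftP ord0 i) => [j|] ->.
    by have := h2 j; rewrite ffunE; congr (v _ == _); apply: val_inj.
  by have := h1 ord0; congr (v _ == _); apply: val_inj.
case: (only_y (n := 1) _) => //=; case: (only_y _) => //; congr g.
by apply/ffunP => j; rewrite !ffunE; congr (v _); apply: val_inj.
Qed.

(** Induction on [n]: the point is lifted to the variety of the ideal with the first variable
    eliminated, then along that variable. *)
Lemma tvar_lift n m (I : tpoly R (n + m) -> Prop) w : trop_closed I ->
  tvar (elim_ideal I) w -> exists2 z, tvar I z & proj_y z = w.
Proof.
elim: n I => [|n IH] I Ic V.
  exists w; last by apply/funext => j; rewrite /proj_y; congr w; apply: val_inj.
  move=> f fI f0; apply: V => //; rewrite /elim_ideal; congr (I _): fI.
  apply/funext => v; rewrite embedE.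
  have -> : only_y (n := 0) v by apply/forallP => -[].
  by congr f; apply/ffunP => j; rewrite ffunE; congr (v _); apply: val_inj.
pose I1 : tpoly R (n + m) -> Prop := elim_ideal (n := 1) (m := n + m) I.
have I1c : trop_closed I1 := @elim_ideal_closed 1 (n + m) I Ic.
have [|z1 V1 z1w] := IH I1 I1c.
  by move=> g; rewrite /elim_ideal /I1 /elim_ideal -ypoly_embedS; apply: V.
have [z Vz zz1] := @tvar_lift1 (n + m) I z1 Ic V1.
exists z => //; rewrite -z1w -zz1; apply/funext => j; rewrite /proj_y.
by congr z; apply: val_inj.
Qed.

End Elimination.

End TropicalProjection.

Theorem theorem4p7 (R : realType) (n m : nat) (I : tpoly R (n + m) -> Prop) :
  tropical_ideal I ->
  forall w : 'I_m -> R,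
    tvar (elim_ideal I) w <->
    exists z : 'I_(n + m) -> R, tvar I z /\ proj_y z = w.
Proof.
move=> /tropical_ideal_closed Ic w; split.
  by move=> /(tvar_lift Ic)[z Vz zw]; exists z.
by move=> [z [Vz <-]]; apply: tvar_proj.
Qed.
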